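(* For every function $g:\mathbb{Z}\times\mathbb{Z}\rightarrow\mathbb{R}$ there exists a function $f:\mathbb{Z}\times\mathbb{Z}\rightarrow\mathbb{R}$ such that the following holds for every primitive amalgam $H>M<K$ of finite groups with $|H:M|=h$ and $|K:M|=k$. (i) Suppose that $H$ has an abelian normal subgroup of index at most $g(h,k)$ (that is, $H$ is abelian by $(h,k)$-bounded). Then $|H|\le f(h,k)$, and hence also $|K|\le f(h,k)$. (ii) Suppose that $H$ and $K$ are subgroups of a finite group $G$ (with $M$ a common subgroup of them in $G$), and that $I$ is a normal subgroup of $G$. If each of $H\cap I$ and $K\cap I$ has an abelian normal subgroup of index at most $g(h,k)$ (that is, both are abelian by $(h,k)$-bounded), then the exponents of $H\cap I$ and $K\cap I$ are both at most $f(h,k)$.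
   Context: A triple of finite groups $(H,M,K)$, written $H>M<K$, is called a primitive amalgam if $M$ is a proper subgroup of both $H$ and $K$ and: (i) whenever $A$ is a non-trivial normal subgroup of $H$ contained in $M$, we have $N_K(A)=M$; and (ii) whenever $B$ is a non-trivial normal subgroup of $K$ contained in $M$, we have $N_H(B)=M$. A quantity is $(h,k)$-bounded if it can be bounded above by a function of $h$ and $k$ only. A finite group is abelian by $(h,k)$-bounded if it has an abelian normal subgroup whose index is $(h,k)$-bounded. The exponent of a finite group is the least positive integer $n$ with $x^n=1$ for all elements $x$. *)

(* Defs.v *)
From mathcomp Require Import all_boot all_order all_algebra all_fingroup all_solvable.
From mathcomp Require Import reals.

Set Implicit Arguments.
Unset Strict Implicit.
Unset Printing Implicit Defensive.

Import GroupScope.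

(* H and K are groups in unrelated ambient types, so "M is a proper subgroup of
   both" means that M comes with embeddings phi and psi onto proper subgroups of
   H and K; M is identified with its two images. *)
Definition amalgam (mT hT kT : finGroupType)
    (H : {group hT}) (M : {group mT}) (K : {group kT})
    (phi : {morphism M >-> hT}) (psi : {morphism M >-> kT}) : Prop :=
  [/\ 'injm phi, 'injm psi, phi @* M \proper H & psi @* M \proper K].

Definition primitive_amalgam (mT hT kT : finGroupType)
    (H : {group hT}) (M : {group mT}) (K : {group kT})
    (phi : {morphism M >-> hT}) (psi : {morphism M >-> kT}) : Prop :=
  [/\ amalgam H K phi psi,
      forall A : {group mT}, A \subset M -> A :!=: 1 ->
        phi @* A <| H -> 'N_K(psi @* A) = psi @* M
    & forall B : {group mT}, B \subset M -> B :!=: 1 ->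
        psi @* B <| K -> 'N_H(phi @* B) = phi @* M].

Definition has_abelian_normal_of_index_le (R : realType) (gT : finGroupType)
    (X : {set gT}) (c : R) : Prop :=
  exists A : {group gT}, [/\ A <| X, abelian A & (#|X : A|%:R <= c)%R].

(* H and K are subgroups of a finite group G in which M is a common subgroup:
   alpha and beta embed H and K in G and agree on M. *)
Definition amalgam_in (mT hT kT gT : finGroupType)
    (H : {group hT}) (M : {group mT}) (K : {group kT})
    (phi : {morphism M >-> hT}) (psi : {morphism M >-> kT}) (G : {group gT})
    (alpha : {morphism H >-> gT}) (beta : {morphism K >-> gT}) : Prop :=
  [/\ 'injm alpha, 'injm beta, alpha @* H \subset G, beta @* K \subset G
    & {in M, forall x, alpha (phi x) = beta (psi x)}].

(* Main.v *)
Require Import Defs.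
From mathcomp Require Import all_boot all_order all_algebra all_fingroup all_solvable.
From mathcomp Require Import reals.
Import GroupScope.

(** (i) Starting from an abelian A_0 <| H of bounded index in M, take cores
    alternately in K and H to get A_0 >= A_1 >= ..., each of bounded index in
    the previous one.  As long as A_(i+2) <> 1, primitivity forces C_H(A_i) and
    C_K(A_(i+1)) into M, so C_M(A_i) and C_M(A_(i+1)) are nontrivial and normal
    one in H and the other in K, hence distinct.  The strictly increasing chain
    of the C_M(A_i) has bounded length, so some A_i is trivial after boundedly
    many steps.

    (ii) After replacing the given abelian subgroups by abelian A <| H and
    B <| K of bounded index contained in M, it suffices to bound the exponent of
    D = A :&: B.  No nontrivial characteristic subgroup of A equals one of B;
    comparing p-torsion subgroups and passing to p-th powers shows that the
    order of every element of D divides #|A : D| * #|B : D|. *)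

(** * Indices of intersections and of normal cores *)

Lemma leq_indexSg {gT : finGroupType} (A B C : {group gT}) :
  A \subset B -> #|A : C| <= #|B : C|.
Proof. by move=> sAB; apply/subset_leq_card/imsetS. Qed.

Lemma leq_indexI {gT : finGroupType} (G A B : {group gT}) :
  #|G : A :&: B| <= #|G : A| * #|G : B|.
Proof.
rewrite -(indexgI G (A :&: B)) setIA -(indexgI G A) -(@Lagrange_index _ G (G :&: A) (G :&: A :&: B)) ?subsetIl //.
by rewrite leq_mul2l (indexgI (G :&: A)) leq_indexSg ?subsetIl ?orbT.
Qed.

Lemma leq_index_bigcap {gT : finGroupType} (G : {group gT}) (n : nat)
    (r : seq {group gT}) :
  {in r, forall X : {group gT}, #|G : X| <= n} ->
  #|G : \bigcap_(X <- r) (X : {set gT})| <= n ^ size r.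
Proof.
elim: r => [|X r IHr] ler; first by rewrite big_nil -indexgI setIT indexgg.
have [Y defY] : exists Y : {group gT}, Y :=: \bigcap_(Z <- r) (Z : {set gT}).
  elim: (r) => [|Z s [Y defY]]; first by exists [set: gT]%G; rewrite big_nil.
  by exists (Z :&: Y)%G; rewrite big_cons -defY.
rewrite big_cons -defY expnS (leq_trans (leq_indexI _ _ _)) // leq_mul ?ler ?mem_head //.
by rewrite defY IHr // => Z rZ; rewrite ler // inE rZ orbT.
Qed.

(** The core is the intersection of the conjugates of [X], all of the same index; there are at most
    [#|G : X|] of them, as [X] normalizes itself. *)
Lemma leq_index_gcore {gT : finGroupType} (G X : {group gT}) :
  X \subset G -> #|G : gcore X G| <= #|G : X| ^ #|G : X|.
Proof.
move=> sXG; pose S := orbit 'JG G X.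
have -> : gcore X G = \bigcap_(Y <- enum S) (Y : {set gT}).
  apply/setP=> y; rewrite big_enum /=; apply/bigcapP/bigcapP => [gy Y | gy x Gx].
    by case/imsetP=> x Gx ->; apply: gy.
  exact: (gy (X :^ x)%G (mem_orbit 'JG X Gx)).
have le_S : size (enum S) <= #|G : X|.
  rewrite -cardE card_orbit astab1JG dvdn_leq ?indexg_gt0 // indexgS //.
  by rewrite subsetI sXG normG.
apply: leq_trans (_ : #|G : X| ^ size (enum S) <= _); last first.
  by rewrite leq_pexp2l ?indexg_gt0.
apply: leq_index_bigcap => Y; rewrite mem_enum => /imsetP[x Gx ->] /=.
by rewrite -{1}(conjGid Gx) /= indexJg.
Qed.

(** * Alternating cores on the two sides of an amalgam *)

(** [P] will be normality of the image in [H] or in [K], so that both sides become predicates on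
    subgroups of [M]. *)
Definition core_bounded {gT : finGroupType} (M : {group gT}) (F : nat -> nat)
    (P : {group gT} -> Prop) : Prop :=
  forall B : {group gT}, B \subset M ->
    exists C : {group gT}, [/\ C \subset B, P C & #|M : C| <= F #|M : B|].

Definition cent_stable {gT : finGroupType} (M : {group gT})
    (P Q : {group gT} -> Prop) : Prop :=
  forall A B : {group gT}, A \subset M -> P A -> Q B -> B :!=: 1 ->
    B \subset A -> P 'C_M(A)%G.

(* For B a core of A on the other side, the centralizers C_M(A) <= C_M(B) are
   normal on opposite sides, hence distinct, unless the core of B is trivial:
   so the index of the centralizer can be used as the induction measure. *)
Lemma leq_order_alternating_cores {gT : finGroupType} (M : {group gT})
    (F : nat -> nat) (n : nat) :
  {homo F : i j / i <= j} -> (forall i, i <= F i) ->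
  forall (P Q : {group gT} -> Prop) (A : {group gT}) (m : nat),
    core_bounded M F P -> core_bounded M F Q ->
    cent_stable M P Q -> cent_stable M Q P ->
    (forall C : {group gT}, C \subset M -> P C -> Q C -> C :=: 1) ->
    A \subset M -> P A -> abelian A -> #|M : 'C_M(A)| <= n -> #|M : A| <= m ->
  #|M| <= iter n.+1 F m.
Proof.
move=> homoF leF; elim: n => [|n IHn] P Q A m coreP coreQ centP centQ PQ1 sAM PA abA.
  by rewrite leqNgt indexg_gt0.
move=> le_cA le_A; have [B [sBA QB le_B]] := coreQ A sAM.
have sBM := subset_trans sBA sAM; have [C [sCB PC le_C]] := coreP B sBM.
have le_Fm : #|M : B| <= F m by apply: leq_trans le_B (homoF _ _ le_A).
have [C1 | ntC] := eqVneq (C : {set gT}) 1.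
  (* Here [#|M|] is at most [F (F m)]; the remaining iterations only enlarge this, as [i <= F i]. *)
  rewrite 2!iterSr -indexg1 -C1 (leq_trans le_C) // (leq_trans (homoF _ _ le_Fm)) //.
  by elim: (n) (F _) => // i IHi j; rewrite iterSr (leq_trans (leF j)).
have ntB : B :!=: 1 by apply: contraNneq ntC => B1; rewrite -subG1 -B1.
have sCMAB : 'C_M(A) \subset 'C_M(B) by rewrite setIS ?centS.
have PCA := centP A B sAM PA QB ntB sBA.
have QCB := centQ B C sBM QB PC ntC sCB.
rewrite iterSr; apply: (IHn Q P B) => //.
- by move=> D sDM QD PD; apply: PQ1.
- exact: abelianS abA.
rewrite -ltnS (leq_trans _ le_cA) // ltn_neqAle dvdn_leq ?indexgS //= andbT.
(* Equal indices would make the two centralizers one group satisfying both [P] and [Q], hence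
   trivial, although it contains [B]. *)
apply: contraNneq ntB => eq_idx.
have eqC : 'C_M(A) :=: 'C_M(B).
  apply/eqP; rewrite eqEcard sCMAB /=.
  by rewrite -(leq_pmul2r (indexg_gt0 M 'C_M(A))) -{1}eq_idx !Lagrange ?subsetIl.
have CA1 : 'C_M(A) :=: 1.
  by apply: PQ1 => //; [apply: subsetIl | rewrite (group_inj eqC)].
by rewrite -subG1 -CA1 subsetI sBM (subset_trans sBA).
Qed.

(** Pull back the core of the image. As [d] only bounds the index, one function can serve both [H]
    and [K]. *)
Lemma core_bounded_morphim {mT hT : finGroupType} {M : {group mT}}
    (phi : {morphism M >-> hT}) (H : {group hT}) (d : nat) :
  'injm phi -> phi @* M \subset H -> #|H : phi @* M| <= d ->
  core_bounded M (fun m => (d * m) ^ (d * m))%N (fun A => phi @* A <| H).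
Proof.
move=> injphi sMH led B sBM; pose L := gcore (phi @* B) H.
have sXH : phi @* B \subset H by apply: subset_trans (morphimS _ sBM) sMH.
have sLX : L \subset phi @* B by apply: gcore_sub.
have phiC : phi @* (phi @*^-1 L) = L.
  by rewrite morphpreK // (subset_trans sLX) // morphimS.
have le_X : #|H : phi @* B| <= (d * #|M : B|)%N.
  by rewrite -(Lagrange_index sMH (morphimS _ sBM)) index_injm // leq_mul2r led orbT.
exists (phi @*^-1 L)%G; split=> /=.
- by rewrite -(injmSK injphi) ?subsetIl //= phiC.
- by rewrite phiC gcore_normal.
rewrite -(@index_injm _ _ _ _ M (phi @*^-1 L) injphi) //= phiC (leq_trans (leq_indexSg _ _ _ sMH)) //.
rewrite (leq_trans (leq_index_gcore _ _ sXH)) //.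
apply: leq_trans (_ : #|H : phi @* B| ^ (d * #|M : B|)%N <= _).
  by rewrite leq_pexp2l.
by rewrite leq_exp2r // (leq_trans (indexg_gt0 _ _) le_X).
Qed.

(** Up to [phi], ['C_H(A)] centralizes [B], so it lies in ['N_H(B)], which is [M]. Hence ['C_M(A)]
    is all of ['C_H(A)], normal in [H] along with [A]. *)
Lemma cent_stable_morphim {mT hT : finGroupType} {M : {group mT}}
    (phi : {morphism M >-> hT}) (H : {group hT}) (Q : {group mT} -> Prop) :
  'injm phi -> phi @* M \subset H ->
  (forall B : {group mT}, B \subset M -> B :!=: 1 -> Q B ->
    'N_H(phi @* B) = phi @* M) ->
  cent_stable M (fun A => phi @* A <| H) Q.
Proof.
move=> injphi sMH normQ A B sAM nAH QB ntB sBA /=.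
have -> : phi @* 'C_M(A) = 'C_H(phi @* A).
  rewrite injm_subcent //; apply/eqP; rewrite eqEsubset setSI //=.
  rewrite subsetI subsetIr andbT -(normQ B) ?(subset_trans sBA) //.
  by rewrite setIS // (subset_trans _ (cent_sub _)) // centS // morphimS.
by rewrite -[X in _ <| X](setIidPl (normal_norm nAH)) subcent_normal.
Qed.

(** * Power maps on abelian groups *)

Lemma expg_morphism_subproof {gT : finGroupType} (n : nat) {A : {group gT}} :
  abelian A -> {in A &, {morph (fun x => x ^+ n) : x y / x * y}}.
Proof. by move=> /centsP cAA x y Ax Ay; apply/expgMn/cAA. Qed.

Definition expg_morphism {gT : finGroupType} (n : nat) {A : {group gT}}
  (abA : abelian A) := Morphism (expg_morphism_subproof n abA).

Lemma expg_morphim_char {gT : finGroupType} (n : nat) {A : {group gT}}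
  (abA : abelian A) : expg_morphism n abA @* A \char A.
Proof.
have sA : expg_morphism n abA @* A \subset A.
  by apply/subsetP=> _ /morphimP[x Ax _ ->]; apply: groupX.
apply/charP; split=> // f injf fA.
apply/eqP; rewrite eqEcard card_injm // leqnn andbT.
apply/subsetP=> _ /morphimP[_ _ /morphimP[x Ax _ ->] ->] /=.
have fAx : f x \in A by have:= mem_morphim f Ax Ax; rewrite fA.
by rewrite morphX //; exact: (mem_morphim (expg_morphism n abA) fAx fAx).
Qed.

Lemma expg_ker_char {gT : finGroupType} (n : nat) {A : {group gT}}
  (abA : abelian A) : 'ker (expg_morphism n abA) \char A.
Proof.
apply/charP; split=> [|f injf fA]; first exact: subsetIl.
apply/eqP; rewrite eqEcard card_injm ?subsetIl // leqnn andbT.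
apply/subsetP=> _ /morphimP[x Ax /kerP/= xn1 ->].
have fAx : f x \in A by have:= mem_morphim f Ax Ax; rewrite fA.
by apply/kerP=> //=; rewrite -morphX // xn1 // morph1.
Qed.

Lemma expg_ker_pgroup {gT : finGroupType} (p : nat) {A : {group gT}}
  (abA : abelian A) : prime p -> p.-group ('ker (expg_morphism p abA)).
Proof.
move=> p_pr; rewrite -pnat_exponent (pnat_dvd _ (pnat_id p_pr)) //.
by apply/exponentP=> x; apply: mker.
Qed.

(** [#|A : D|] is the index of the images times that of [D] in the kernel, a power of [p] which is
    not 1 since the kernel is not inside [D]. *)
Lemma expg_index_dvd {gT : finGroupType} (p : nat) {A D : {group gT}}
    (abA : abelian A) :
  prime p -> D \subset A -> ~~ ('ker (expg_morphism p abA) \subset D) ->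
  (p * #|expg_morphism p abA @* A : expg_morphism p abA @* D|)%N %| #|A : D|.
Proof.
move=> p_pr sDA nsD; set f := expg_morphism p abA.
rewrite -(index_morphim_ker f sDA) // mulnC dvdn_mul //.
rewrite (setIidPr _) ?subsetIl //.
have: p.-nat #|'ker f : D| by apply: pnat_dvd (dvdn_indexg _ _) (expg_ker_pgroup p abA p_pr).
case/p_natP=> -[|k ->]; last by rewrite expnS dvdn_mulr.
by move/eqP; rewrite indexg_eq1 (negPf nsD).
Qed.

(* If the p-torsion subgroups of A, B and D agree for some prime p dividing
   #[x], then P and Q share a nontrivial group.  Otherwise passing to p-th
   powers divides both #[x] and the product of the indices by p. *)
Lemma order_dvd_index_mul {gT : finGroupType} (P Q : {group gT} -> Prop) :
  (forall A C : {group gT}, P A -> C \char A -> P C) ->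
  (forall B C : {group gT}, Q B -> C \char B -> Q C) ->
  (forall C : {group gT}, P C -> Q C -> C :=: 1) ->
  forall (A B D : {group gT}) (x : gT),
    P A -> Q B -> abelian A -> abelian B -> D \subset A -> D \subset B ->
    x \in D -> #[x] %| (#|A : D| * #|B : D|)%N.
Proof.
move=> charP charQ PQ1 A B D x; have [n] := ubnP #[x].
elim: n A B D x => // n IHn A B D x lexn PA QB abA abB sDA sDB Dx.
have [->|nt_x] := eqVneq x 1; first by rewrite order1 dvd1n.
have p_pr : prime (pdiv #[x]) by rewrite pdiv_prime ?order_gt1.
set p := pdiv #[x] in p_pr; have p_dv : p %| #[x] by apply: pdiv_dvd.
pose f := expg_morphism p abA; pose g := expg_morphism p abB.
have [/andP[sfD sgD] | nsD] := boolP (('ker f \subset D) && ('ker g \subset D)).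
  (* The [p]-torsion of [A] and that of [B] both lie in [D], hence in both groups. *)
  have eq_ker : 'ker f = 'ker g.
    apply/setP=> y; apply/idP/idP=> ky; apply/kerP; try exact: (mker ky).
      exact: subsetP sDB _ (subsetP sfD _ ky).
    exact: subsetP sDA _ (subsetP sgD _ ky).
  have Qker : Q ('ker f)%G.
    by apply: (charQ B) => //=; rewrite eq_ker expg_ker_char.
  have ker1 := PQ1 _ (charP _ _ PA (expg_ker_char p abA)) Qker.
  have: x ^+ (#[x] %/ p) \in 'ker f.
    apply/kerP; first by rewrite groupX // (subsetP sDA).
    by rewrite /= -expgM divnK // expg_order.
  rewrite ker1 inE -order_eq1 orderXdiv ?dvdn_div // divnA // mulKn //.
  by rewrite eqn_leq leqNgt prime_gt1.
have eqfgD : f @* D = g @* D.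
  by rewrite !morphimEsub.
have xp_dv : #[x ^+ p] %| (#|f @* A : f @* D| * #|g @* B : f @* D|)%N.
  apply: IHn (charP _ _ PA (expg_morphim_char p abA))
    (charQ _ _ QB (expg_morphim_char p abB)) _ _ _ _ _.
  - rewrite orderXdiv // -ltnS (leq_trans _ lexn) // ltnS ltn_Pdiv ?prime_gt1 //.
  - exact: morphim_abelian.
  - exact: morphim_abelian.
  - exact: morphimS.
  - by rewrite /= eqfgD morphimS.
  by apply: (mem_morphim f) => //; apply: (subsetP sDA).
have p_xp : (p * #[x ^+ p])%N = #[x] by rewrite orderXdiv // mulnC divnK.
rewrite -p_xp; apply: dvdn_trans (dvdn_mul (dvdnn p) xp_dv) _.
(* The index whose kernel is not inside [D] absorbs the factor [p]; the other index of images merely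
   divides the original one. *)
case/nandP: nsD => nsD.
  rewrite mulnA dvdn_mul ?expg_index_dvd //.
  by rewrite eqfgD index_morphim // (subset_trans (subsetIl _ _)).
rewrite mulnCA dvdn_mul //; last by rewrite eqfgD expg_index_dvd.
by rewrite index_morphim // (subset_trans (subsetIl _ _)).
Qed.

(** * Normal abelian subgroups of bounded index *)

Lemma leq_index_centI {gT : finGroupType} (X A : {group gT}) :
  A \subset X -> abelian A -> #|X : 'C_X(A)| <= #|X : A|.
Proof.
by move=> sAX abA; rewrite dvdn_leq ?indexg_gt0 // indexgS // subsetI sAX.
Qed.

(* The subgroup generated by all conjugates of A is already generated by at most
   n of them, so its center contains an intersection of at most n + 1 of them. *)
Lemma exists_normal_abelian {gT : finGroupType} (H X A : {group gT}) (n : nat) :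
  X <| H -> A \subset X -> abelian A -> #|X : A| <= n ->
  exists C : {group gT},
    [/\ C <| H, C \subset X, abelian C & #|X : C| <= n ^ n.+2].
Proof.
move=> nXH sAX abA le_n; pose N := <<class_support A H>>%G.
have sAN : A \subset N by rewrite sub_gen // sub_class_support.
have sNX : N \subset X.
  rewrite gen_subG class_supportEr; apply/bigcupsP=> x Hx.
  by rewrite -(normP (subsetP (normal_norm nXH) x Hx)) conjSg.
have nNH : N <| H.
  by rewrite /normal (subset_trans sNX (normal_sub nXH)) norms_gen ?class_support_norm.
have n_gt0 : 0 < n by apply: leq_trans le_n.
(* Joining to [E] a conjugate not contained in it lowers [#|X : E|], bounded by [j], and multiplies
   the index of the centralizer by at most [n]. *)
have cN j (E : {group gT}) m : E \subset N -> #|X : E| <= j ->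
    #|X : 'C_X(E)| <= m -> #|X : 'C_X(N)| <= m * n ^ j.
  elim: j E m => [|j IHj] E m sEN leE le_m; first by rewrite leqNgt indexg_gt0 in leE.
  have [sNE | ] := boolP (N \subset E).
    have -> : N :=: E by apply/eqP; rewrite eqEsubset sNE.
    by rewrite (leq_trans le_m) // leq_pmulr // expn_gt0 n_gt0.
  rewrite gen_subG class_supportEr => /bigcupsP nsE.
  have [x Hx nsxE] : exists2 x, x \in H & ~~ (A :^ x \subset E).
    apply/exists_inP; apply: contraPT isT => /exists_inPn sE; case: nsE => x Hx.
    by have:= sE x Hx; rewrite negbK.
  have sAxX : A :^ x \subset X.
    by rewrite -(normP (subsetP (normal_norm nXH) x Hx)) conjSg.
  rewrite expnS mulnA; apply: (IHj (E <*> (A :^ x))%G).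
  - rewrite join_subG sEN sub_gen // class_supportEr; exact: bigcup_sup.
  - rewrite -ltnS (leq_trans _ leE) // ltnNge; apply: contra nsxE => le_idx.
    have sEE : E \subset E <*> (A :^ x) by apply: joing_subl.
    have sEX : E <*> (A :^ x) \subset X by rewrite join_subG (subset_trans sEN).
    have := indexg_eq1 (E <*> (A :^ x)) E; rewrite join_subG subxx /= => <-.
    rewrite eqn_leq indexg_gt0 andbT -(leq_pmul2l (indexg_gt0 X (E <*> (A :^ x)))).
    by rewrite Lagrange_index // muln1.
  rewrite /= centY setIIr (leq_trans (leq_indexI _ _ _)) // leq_mul //.
  rewrite (leq_trans (leq_index_centI _ (A :^ x) _ _)) ?abelianJ //.
  by rewrite -(normP (subsetP (normal_norm nXH) x Hx)) indexJg.
have le_cN := cN n A n sAN le_n (leq_trans (leq_index_centI X A sAX abA) le_n).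
exists 'Z(N)%G; split; rewrite ?center_abelian //.
- exact: char_normal_trans (center_char N) nNH.
- exact: subset_trans (center_sub N) sNX.
(* [N] contributes a factor [n] and its centralizer [n * n ^ n]. *)
rewrite /= /center -(setIidPl sNX) -setIA (leq_trans (leq_indexI _ _ _)) //.
rewrite (setIidPl sNX) expnS leq_mul // ?expnS //.
by rewrite (leq_trans _ le_n) // dvdn_leq ?indexg_gt0 ?indexgS.
Qed.

(** * Exponents when both groups are abelian by bounded *)

Lemma expg_index_mem {gT : finGroupType} (G A : {group gT}) (x : gT) :
  A <| G -> x \in G -> x ^+ #|G : A| \in A.
Proof.
move=> nAG Gx; have Nx := subsetP (normal_norm nAG) x Gx.
rewrite coset_idr ?groupX // morphX // -card_quotient ?normal_norm //.
by rewrite expg_cardG // mem_quotient.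
Qed.

(** Only [X] is treated: hypotheses and bound are symmetric, so exchanging the two sides gives
    [Y]. *)
Lemma leq_exponent_of_abelian_pair {gT : finGroupType} (H M K X Y : {group gT})
    (n : nat) :
  let c := (n ^ n.+2)%N in let h := #|H : M| in let k := #|K : M| in
  M \subset H -> M \subset K -> X <| H -> Y <| K -> M :&: X = M :&: Y ->
  (forall C : {group gT}, C \subset M -> C <| H -> C <| K -> C :=: 1) ->
  (exists A : {group gT}, [/\ A \subset X, abelian A & #|X : A| <= n]) ->
  (exists B : {group gT}, [/\ B \subset Y, abelian B & #|Y : B| <= n]) ->
  exponent X <= ((c * h ^ h) * (c * k ^ k)) ^ 2.
Proof.
move=> c h k sMH sMK nXH nYK eqI disj [A0 [sA0 abA0 leA0]] [B0 [sB0 abB0 leB0]].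
(* Intersecting with the core of [M] in [L] brings the normal abelian subgroup into [M]. *)
have sub_core (L Z C0 : {group gT}) : M \subset L -> Z <| L -> C0 \subset Z ->
    abelian C0 -> #|Z : C0| <= n ->
  exists C : {group gT}, [/\ C <| L, C \subset M, C \subset Z, abelian C
    & #|Z : C| <= c * #|L : M| ^ #|L : M|].
  move=> sML nZL sCZ abC leC.
  have [C [nCL sCZ' abC' leC']] := exists_normal_abelian _ _ _ _ nZL sCZ abC leC.
  exists (C :&: gcore M L)%G; split.
  - by rewrite normalI ?gcore_normal.
  - by rewrite subIset // gcore_sub orbT.
  - by rewrite subIset // sCZ'.
  - by rewrite (abelianS _ abC') ?subsetIl.
  rewrite (leq_trans (leq_indexI _ _ _)) // leq_mul //.
  by rewrite (leq_trans (leq_indexSg _ _ _ (normal_sub nZL))) ?leq_index_gcore.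
have [A [nAH sAM sAX abA leA]] := sub_core H X A0 sMH nXH sA0 abA0 leA0.
have [B [nBK sBM sBY abB leB]] := sub_core K Y B0 sMK nYK sB0 abB0 leB0.
(* Since [A] lies in [M :&: X], which is [M :&: Y], the index of [B] in [Y] will bound that of [D]
   in [A]. *)
have sAY : A \subset Y by rewrite (subset_trans _ (subsetIr M Y)) // -eqI subsetI sAM.
have sBX : B \subset X by rewrite (subset_trans _ (subsetIr M X)) // eqI subsetI sBM.
pose D := (A :&: B)%G.
have leAD : #|A : D| <= c * k ^ k.
  by rewrite indexgI (leq_trans (leq_indexSg _ _ _ sAY)).
have leBD : #|B : D| <= c * h ^ h.
  by rewrite /= setIC indexgI (leq_trans (leq_indexSg _ _ _ sBX)).
have nDA : D <| A by rewrite -sub_abelian_normal // subsetIl.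
(* The first factor sends elements of [X] into [A], the second sends these into [D], and the last
   kills [D]. *)
pose e := (#|X : A| * #|A : D| * (#|A : D| * #|B : D|))%N.
have le_e : e <= ((c * h ^ h) * (c * k ^ k)) ^ 2.
  rewrite -mulnn leq_mul //; first exact: leq_mul.
  by rewrite [(#|A : D| * _)%N]mulnC leq_mul.
apply: leq_trans le_e; apply: dvdn_leq; first by rewrite !muln_gt0 !indexg_gt0.
apply/exponentP=> x Xx; apply/eqP; rewrite /e expgM -order_dvdn.
apply: (order_dvd_index_mul (fun C => C \subset M /\ C <| H)
                            (fun C => C \subset M /\ C <| K)) => //.
- move=> C C' [sCM nCH] chC'; split; first exact: subset_trans (char_sub chC') sCM.
  exact: char_normal_trans chC' nCH.
- move=> C C' [sCM nCH] chC'; split; first exact: subset_trans (char_sub chC') sCM.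
  exact: char_normal_trans chC' nCH.
- by move=> C [sCM nCH] [_]; apply: disj.
- exact: subsetIl.
- exact: subsetIr.
rewrite expgM expg_index_mem // expg_index_mem //.
exact: normalS sAX (normal_sub nXH) nAH.
Qed.

(** * Bounds for primitive amalgams *)

(** If [C] were nontrivial, its normalizer in [K] would be [M] by primitivity and [K] by normality,
    but [M] is proper in [K]. *)
Lemma primitive_amalgam_normal_eq1 {mT hT kT : finGroupType}
    {H : {group hT}} {M : {group mT}} {K : {group kT}}
    {phi : {morphism M >-> hT}} {psi : {morphism M >-> kT}} :
  primitive_amalgam H K phi psi ->
  forall C : {group mT}, C \subset M -> phi @* C <| H -> psi @* C <| K ->
    C :=: 1.
Proof.
move=> [[_ _ _ prK] primH _] C sCM nCH nCK; apply/eqP/contraT=> ntC.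
by move: prK; rewrite -(primH C) // (setIidPl (normal_norm nCK)) properxx.
Qed.

(** The product [h * k] dominates both indices. [F n] occurs twice because it bounds the index in
    [M] of the first core and that of its centralizer. *)
Definition abelian_order_bound (h k n : nat) : nat :=
  let F m := ((h * k * m) ^ (h * k * m))%N in iter (F n).+1 F (F n).

Lemma primitive_amalgam_order {mT hT kT : finGroupType}
    {H : {group hT}} {M : {group mT}} {K : {group kT}}
    {phi : {morphism M >-> hT}} {psi : {morphism M >-> kT}} (A : {group hT}) (n : nat) :
  primitive_amalgam H K phi psi -> A \subset H -> abelian A -> #|H : A| <= n ->
  #|M| <= abelian_order_bound #|H : phi @* M| #|K : psi @* M| n.
Proof.
move=> prim sAH abA le_n; have disj := primitive_amalgam_normal_eq1 prim.
have [[injphi injpsi /proper_sub sMH /proper_sub sMK] primH primK] := prim.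
rewrite /abelian_order_bound; set d := (#|H : _| * #|K : _|)%N; pose F m := ((d * m) ^ (d * m))%N.
have leH : #|H : phi @* M| <= d by rewrite leq_pmulr.
have leK : #|K : psi @* M| <= d by rewrite leq_pmull.
have d_gt0 : 0 < d by rewrite muln_gt0 !indexg_gt0.
have dm_gt0 i : 0 < i -> (0 < d * i)%N by rewrite muln_gt0 d_gt0.
have leF i : i <= F i.
  case: i => // i; apply: leq_trans (leq_pmull i.+1 d_gt0) _.
  by rewrite /F -[X in X <= _]expn1 leq_pexp2l ?dm_gt0.
have homoF : {homo F : i j / i <= j}.
  (* At 0 the function takes the value [0 ^ 0], which is 1. *)
  move=> [|i] j le_ij; first
    by case: j le_ij => [|j] _; rewrite /F ?muln0 // expn_gt0 dm_gt0.
  have le_d : (d * i.+1 <= d * j)%N by rewrite leq_mul2l le_ij orbT.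
  apply: leq_trans (_ : ((d * j) ^ (d * i.+1))%N <= _).
    by rewrite leq_exp2r ?dm_gt0.
  by rewrite leq_pexp2l // dm_gt0 // (leq_trans _ le_ij).
have coreP := core_bounded_morphim phi H d injphi sMH leH.
have coreQ := core_bounded_morphim psi K d injpsi sMK leK.
have injA : phi @* (phi @*^-1 A) = phi @* M :&: A by rewrite -morphpreIim morphpreK ?subsetIl.
have abB : abelian (phi @*^-1 A).
  by rewrite -(injm_abelian injphi) ?subsetIl //= injA (abelianS _ abA) ?subsetIr.
have le_B : #|M : phi @*^-1 A| <= n.
  rewrite -(@index_injm _ _ _ _ M (phi @*^-1 A) injphi) //= injA indexgI.
  exact: leq_trans (leq_indexSg _ _ _ sMH) le_n.
have [C [sCB nCH leC]] := coreP (phi @*^-1 A)%G (subsetIl _ _).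
have sCM : C \subset M := subset_trans sCB (subsetIl _ _).
have abC : abelian C := abelianS sCB abB.
have leCF : #|M : C| <= F n := leq_trans leC (homoF _ _ le_B).
apply: (leq_order_alternating_cores M F (F n) homoF leF
  (fun A0 => phi @* A0 <| H) (fun B0 => psi @* B0 <| K) C) => //.
- exact: cent_stable_morphim.
- by apply: cent_stable_morphim => // B sBM ntB; apply: primH.
exact: leq_trans (leq_index_centI _ _ sCM abC) leCF.
Qed.

Definition exponent_bound (h k n : nat) : nat :=
  (((n ^ n.+2 * h ^ h) * (n ^ n.+2 * k ^ k)) ^ 2)%N.

(** Inside [G] the two embeddings of [M] have the same image [L], so [H] and [K] become subgroups
    sharing [L], and [I] meets [L] in the same group from either side. *)
Lemma primitive_amalgam_exponent {mT hT kT gT : finGroupType}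
    {H : {group hT}} {M : {group mT}} {K : {group kT}}
    {phi : {morphism M >-> hT}} {psi : {morphism M >-> kT}} {G I : {group gT}}
    {alpha : {morphism H >-> gT}} {beta : {morphism K >-> gT}} (n : nat) :
  primitive_amalgam H K phi psi -> amalgam_in phi psi G alpha beta -> I <| G ->
  (exists A : {group gT},
    [/\ A \subset alpha @* H :&: I, abelian A & #|alpha @* H :&: I : A| <= n]) ->
  (exists B : {group gT},
    [/\ B \subset beta @* K :&: I, abelian B & #|beta @* K :&: I : B| <= n]) ->
  let e := exponent_bound #|H : phi @* M| #|K : psi @* M| n in
  exponent (alpha @* H :&: I) <= e /\ exponent (beta @* K :&: I) <= e.
Proof.
move=> prim [inja injb sHG sKG eqab] nIG AX BY.
have disj := primitive_amalgam_normal_eq1 prim.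
have [[injphi injpsi /proper_sub sMH /proper_sub sMK] _ _] := prim.
have eqAB (C : {group mT}) : C \subset M -> alpha @* (phi @* C) = beta @* (psi @* C).
  move=> sCM; rewrite (morphimEsub alpha) ?(subset_trans (morphimS _ sCM)) //.
  rewrite (morphimEsub beta) ?(subset_trans (morphimS _ sCM)) // !morphimEsub //.
  rewrite -!imset_comp; apply: eq_in_imset => x Cx /=.
  exact/eqab/(subsetP sCM).
pose L := (alpha @* (phi @* M))%G.
have sLH : L \subset alpha @* H by apply: morphimS.
have sLK : L \subset beta @* K by rewrite /= (eqAB M) ?morphimS.
have idxH : #|alpha @* H : L| = #|H : phi @* M| by rewrite index_injm.
have idxK : #|beta @* K : L| = #|K : psi @* M| by rewrite /= (eqAB M) ?index_injm.
have nIH : alpha @* H :&: I <| alpha @* H.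
  by rewrite /normal subsetIl normsI ?normG // (subset_trans sHG) ?normal_norm.
have nIK : beta @* K :&: I <| beta @* K.
  by rewrite /normal subsetIl normsI ?normG // (subset_trans sKG) ?normal_norm.
have eqI : L :&: (alpha @* H :&: I) = L :&: (beta @* K :&: I).
  by rewrite !setIA (setIidPl sLH) (setIidPl sLK).
have disjL (C : {group gT}) :
  C \subset L -> C <| alpha @* H -> C <| beta @* K -> C :=: 1.
  move=> sCL nCH nCK; pose C1 := (alpha @*^-1 C)%G; pose C0 := (phi @*^-1 C1)%G.
  have sC1 : C1 \subset phi @* M.
    by rewrite -(injmSK inja) ?subsetIl //= morphpreK // (subset_trans sCL).
  have eC1 : alpha @* C1 = C by rewrite /= morphpreK // (subset_trans sCL).
  have eC0 : phi @* C0 = C1 by rewrite /= morphpreK.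
  have sC0M : C0 \subset M by apply: subsetIl.
  have C01 : C0 :=: 1.
    apply: disj => //.
      by rewrite eC0 -(injm_normal inja) ?subsetIl //= eC1.
    rewrite -(injm_normal injb) ?(subset_trans (morphimS _ sC0M)) //=.
    by rewrite -eqAB // [phi @* _]eC0 eC1.
  by rewrite -eC1 -eC0 C01 !morphim1.
have bnd := leq_exponent_of_abelian_pair.
split.
  have := bnd _ (alpha @* H)%G L (beta @* K)%G (alpha @* H :&: I)%G
    (beta @* K :&: I)%G n sLH sLK nIH nIK eqI disjL AX BY.
  by rewrite idxH idxK.
have := bnd _ (beta @* K)%G L (alpha @* H)%G (beta @* K :&: I)%G
  (alpha @* H :&: I)%G n sLK sLH nIK nIH (esym eqI)
  (fun C sCL nCK nCH => disjL C sCL nCH nCK) BY AX.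
by rewrite idxH idxK mulnC.
Qed.

Theorem theorem2p2 (R : realType) (g : int * int -> R) :
  exists f : int * int -> R,
  forall (mT hT kT : finGroupType)
         (H : {group hT}) (M : {group mT}) (K : {group kT})
         (phi : {morphism M >-> hT}) (psi : {morphism M >-> kT}) (h k : nat),
    primitive_amalgam H K phi psi ->
    #|H : phi @* M| = h ->
    #|K : psi @* M| = k ->
    (has_abelian_normal_of_index_le H (g (h%:Z, k%:Z)%R) ->
       (#|H|%:R <= f (h%:Z, k%:Z))%R /\ (#|K|%:R <= f (h%:Z, k%:Z))%R)
    /\
    (forall (gT : finGroupType) (G I : {group gT})
            (alpha : {morphism H >-> gT}) (beta : {morphism K >-> gT}),
       amalgam_in phi psi G alpha beta ->
       I <| G ->
       has_abelian_normal_of_index_le (alpha @* H :&: I) (g (h%:Z, k%:Z)%R) ->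
       has_abelian_normal_of_index_le (beta @* K :&: I) (g (h%:Z, k%:Z)%R) ->
       ((exponent (alpha @* H :&: I))%:R <= f (h%:Z, k%:Z))%R /\
       ((exponent (beta @* K :&: I))%:R <= f (h%:Z, k%:Z))%R).
Proof.
pose bd h k n := (h * k * abelian_order_bound h k n + exponent_bound h k n)%N.
(* Indices are natural numbers, so the real bound [g z] may be truncated; absolute values recover
   [h] and [k] from the integer arguments. *)
exists (fun z => (bd `|z.1|%N `|z.2|%N (Num.truncn (g z)))%:R)%R.
move=> mT hT kT H M K phi psi h k prim idxH idxK; rewrite !absz_nat.
set c := g _; set n := Num.truncn c.
have [[injphi injpsi /proper_sub sMH /proper_sub sMK] _ _] := prim.
have le_n (m : nat) : (m%:R <= c)%R -> m <= n.
  move=> le_mc; rewrite Num.Theory.truncn_ge_nat //.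
  exact: Order.POrderTheory.le_trans (Num.Theory.ler0n _ _) le_mc.
split=> [[A [nAH abA /le_n leA]] | gT G I alpha beta am nIG].
  have leM := primitive_amalgam_order A n prim (normal_sub nAH) abA leA.
  rewrite idxH idxK in leM.
  have h_gt0 : 0 < h by rewrite -idxH.
  have k_gt0 : 0 < k by rewrite -idxK.
  rewrite !Num.Theory.ler_nat; split; apply: leq_trans (leq_addr _ _).
    rewrite -(Lagrange sMH) idxH card_injm // mulnC leq_mul //.
    by rewrite leq_pmulr.
  rewrite -(Lagrange sMK) idxK card_injm // mulnC leq_mul //.
  by rewrite leq_pmull.
move=> [A [nA abA /le_n leA]] [B [nB abB /le_n leB]].
have [] := primitive_amalgam_exponent n prim am nIG.
- by exists A; rewrite normal_sub.
- by exists B; rewrite normal_sub.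
rewrite idxH idxK !Num.Theory.ler_nat => leH leK.
by split; [apply: leq_trans leH _ | apply: leq_trans leK _]; apply: leq_addl.
Qed.
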